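(* Let $\mathcal{H}=\mathcal{H}(\Omega)$ be a functional (reproducing kernel) Hilbert space on a nonempty set $\Omega$, let $t\in[0,1]$ and let $A\in\mathcal{B}(\mathcal{H})$ be invertible. Then $A$ is unitary if and only if $\|A^*A\|_{t-ber}\le1$ and $\|(A^*A)^{-1}\|_{t-ber}\le1$.
   Context: A functional (reproducing kernel) Hilbert space $\mathcal{H}=\mathcal{H}(\Omega)$ is a Hilbert space of complex-valued functions on a nonempty set $\Omega$ such that for every $\lambda\in\Omega$ the evaluation $f\mapsto f(\lambda)$ is a continuous linear functional; $k_\lambda\in\mathcal{H}$ is the unique element with $f(\lambda)=\langle f,k_\lambda\rangle$ for all $f\in\mathcal{H}$. It is assumed that $k_\lambda\neq0$ for all $\lambda\in\Omega$, and $\hat{k}_\lambda=k_\lambda/\|k_\lambda\|$ is the normalized reproducing kernel. $\mathcal{B}(\mathcal{H})$ is the algebra of bounded linear operators on $\mathcal{H}$. For $A\in\mathcal{B}(\mathcal{H})$ and $t\in[0,1]$, $$\|A\|_{t-ber}=\sup_{\lambda,\mu\in\Omega}\left\{t|\langle A\hat{k}_\lambda,\hat{k}_\mu\rangle|+(1-t)|\langle A^*\hat{k}_\lambda,\hat{k}_\mu\rangle|\right\}.$$ *)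

(* Defs.v *)
From HB Require Import structures.
From mathcomp Require Import all_boot all_order all_algebra complex.
From mathcomp Require Import boolp classical_sets reals topology normedtype.

Set Implicit Arguments.
Unset Strict Implicit.
Unset Printing Implicit Defensive.

Import Order.TTheory GRing.Theory Num.Theory.
Import numFieldNormedType.Exports.

Local Open Scope classical_set_scope.
Local Open Scope ring_scope.

(* The form is linear in its first argument and conjugate-linear in the second;
   completeness is with respect to the norm it induces. *)
HB.mixin Record isHilbert (R : realType) H of CompleteNormedModule R[i] H := {
  hdot : {dot H for (@Num.conj R[i])};
  hdot_norm : forall x : H, `|x| ^+ 2 = hdot x x
}.

#[short(type="hilbertType")]
HB.structure Definition Hilbert (R : realType) :=
  {H of CompleteNormedModule R[i] H & isHilbert R H}.

(* A Hilbert space of functions on Omega is an abstract Hilbert space whose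
   vectors are faithfully represented as functions Omega -> C by [feval],
   the vector space operations being the pointwise ones. *)
HB.mixin Record isFunctionSpace (R : realType) (Omega : Type) H
    of Hilbert R H := {
  feval : H -> Omega -> R[i];
  feval_inj : injective feval;
  feval_linear : forall l : Omega, linear (fun f : H => feval f l : R[i]^o);
  feval_continuous : forall l : Omega,
    continuous (fun f : H => feval f l : R[i]^o)
}.

#[short(type="functionalHilbertType")]
HB.structure Definition FunctionalHilbert (R : realType) (Omega : Type) :=
  {H of Hilbert R H & isFunctionSpace R Omega H}.

#[short(type="boundedOperator")]
HB.structure Definition BoundedOperator (R : realType) (H : hilbertType R) :=
  {f of @GRing.Linear R[i] H H *:%R f & @Continuous H H f}.

Section operators.
Context {R : realType} {H : hilbertType R}.
Implicit Types A B : boundedOperator H.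

HB.instance Definition _ := gen_eqMixin (boundedOperator H).
HB.instance Definition _ := gen_choiceMixin (boundedOperator H).

Definition opcomp A B : H -> H := A \o B.
HB.instance Definition _ A B := GRing.Linear.copy (opcomp A B) (A \o B).
HB.instance Definition _ A B := Continuous.copy (opcomp A B) (A \o B).

(* The set below is a singleton by the Riesz representation theorem, so the
   default value A is never returned. *)
Definition adjoint A : boundedOperator H :=
  xget A [set B | forall x y : H, hdot (A x) y = hdot x (B y)].

Definition is_inverse A B := cancel A B /\ cancel B A.

Definition invertible A := exists B, is_inverse A B.

(* Meaningful for invertible operators only; A itself otherwise. *)
Definition opinv A : boundedOperator H := xget A [set B | is_inverse A B].

Definition unitary A :=
  opcomp (adjoint A) A =1 idfun /\ opcomp A (adjoint A) =1 idfun.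

End operators.

Section berezin.
Context {R : realType} {Omega : Type} {H : functionalHilbertType R Omega}.

(* The set below is a singleton by the Riesz representation theorem, so the
   default value 0 plays no role. *)
Definition rkernel (l : Omega) : H :=
  xget 0 [set k : H | forall f : H, feval f l = hdot f k].

Definition nrkernel (l : Omega) : H := `|rkernel l|^-1 *: rkernel l.

(* [Normc.normc] is the real-valued modulus on R[i]. The supremum is over a set
   bounded above, by Cauchy-Schwarz, when 0 <= t <= 1. *)
Definition tber (t : R) (A : boundedOperator H) : R :=
  sup [set r | exists l m : Omega,
    r = t * Normc.normc (hdot (A (nrkernel l)) (nrkernel m))
        + (1 - t) * Normc.normc (hdot (adjoint A (nrkernel l)) (nrkernel m))].

End berezin.

(* Main.v *)
Require Import Defs.
From HB Require Import structures.
From mathcomp Require Import all_boot all_order all_algebra complex.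
From mathcomp Require Import boolp classical_sets reals topology normedtype.
From mathcomp Require Import interval_inference ring lra.

(** Write T = A^* A. When A is unitary, T and its inverse are the identity, and
    both norms are suprema of moduli of inner products of unit vectors, hence at
    most 1 by the Cauchy-Schwarz inequality.

    Conversely, put S = T^-1 and let k be a normalized reproducing kernel. The
    diagonal terms of the two norms give <T k, k> <= 1 and <S k, k> <= 1, so
      |A (k - S k)|^2 = <T (k - S k), k - S k> = <T k, k> + <S k, k> - 2 <= 0,
    which forces A (k - S k) = 0 and then T k = k ([gram_fixed_point]). Since
    values of functions are inner products with kernels and T is self-adjoint,
    (T f)(l) = <T f, k_l> = <f, T k_l> = f(l) for all f and l, so T = 1. The
    operator A being surjective, A A^* = 1 follows from A^* A = 1.

    The adjoint [adjoint A] is characterized by its defining identity only once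
    such an operator is known to exist, which is the Riesz representation
    theorem ([riesz]): a bounded linear form f is the inner product with a
    multiple of the vector of least norm in the hyperplane f = 1. That vector
    exists by completeness and the parallelogram identity ([min_norm_point]).
    Reproducing kernels need no such argument, because their non-vanishing rules
    out the default value 0 of [rkernel]. *)

Set Implicit Arguments.
Unset Strict Implicit.
Unset Printing Implicit Defensive.

Import Order.TTheory GRing.Theory Num.Theory.
Import numFieldNormedType.Exports.

Local Open Scope classical_set_scope.
Local Open Scope ring_scope.

(** * Inner products *)

Section InnerProduct.
Context {R : realType} {H : hilbertType R}.
Implicit Types (x y z : H) (a c : R[i]).

Lemma hdotC x y : hdot y x = (hdot x y)^*%R.
Proof. by rewrite (hermC (hdot (s:=H)) y x) /= expr0 mul1r. Qed.

Lemma hdot0l x : hdot 0 x = 0.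
Proof. exact: linear0l. Qed.

Lemma hdot0r x : hdot x 0 = 0.
Proof. exact: linear0r. Qed.

Lemma hdotDl x y z : hdot (x + y) z = hdot x z + hdot y z.
Proof. exact: linearDl. Qed.

Lemma hdotBl x y z : hdot (x - y) z = hdot x z - hdot y z.
Proof. exact: linearBl. Qed.

Lemma hdotZl a x y : hdot (a *: x) y = a * hdot x y.
Proof. exact: linearZl_LR. Qed.

Lemma hdotDr x y z : hdot x (y + z) = hdot x y + hdot x z.
Proof. exact: linearDr. Qed.

Lemma hdotBr x y z : hdot x (y - z) = hdot x y - hdot x z.
Proof. exact: linearBr. Qed.

Lemma hdotZr a x y : hdot x (a *: y) = a^*%R * hdot x y.
Proof. exact: linearZr_LR. Qed.

Lemma hdot_eq0 x : hdot x x = 0 -> x = 0.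
Proof. by rewrite -hdot_norm => /eqP; rewrite expf_eq0 normr_eq0 => /eqP. Qed.

Lemma hdot_injr x y : (forall z, hdot z x = hdot z y) -> x = y.
Proof.
move=> e; apply/eqP; rewrite -subr_eq0; apply/eqP/hdot_eq0.
by rewrite hdotBr e subrr.
Qed.

Lemma norm_subZ x y c :
  `|x - c *: y| ^+ 2
  = `|x| ^+ 2 - (c^*%R * hdot x y + c * (hdot x y)^*%R) + c * c^*%R * `|y| ^+ 2.
Proof.
rewrite !hdot_norm hdotBl !hdotBr !hdotZl !hdotZr (hdotC x y); ring.
Qed.

(** Pythagoras for the component of x orthogonal to y. *)
Lemma norm_sub_proj x y : y != 0 ->
  `|x - (hdot x y / `|y| ^+ 2) *: y| ^+ 2
  = `|x| ^+ 2 - `|hdot x y| ^+ 2 / `|y| ^+ 2.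
Proof.
move=> y0; rewrite norm_subZ normCK rmorphM fmorphV /= rmorphXn /=.
rewrite (CrealP (normr_real y)).
have : `|y| != 0 by rewrite normr_eq0.
move: (`|y|) => n n0; field; exact: n0.
Qed.

Lemma CauchySchwarz_norm x y : `|hdot x y| <= `|x| * `|y|.
Proof.
have [->|y0] := eqVneq y 0; first by rewrite hdot0r !normr0 mulr0.
rewrite -ler_sqr ?nnegrE ?mulr_ge0 ?normr_ge0// exprMn.
rewrite -ler_pdivrMr ?exprn_gt0 ?normr_gt0// -subr_ge0.
by rewrite -norm_sub_proj// exprn_ge0.
Qed.

Lemma parallelogram x y :
  `|x - y| ^+ 2 = 2 * `|x| ^+ 2 + 2 * `|y| ^+ 2 - `|x + y| ^+ 2.
Proof. by rewrite !hdot_norm !(hdotBl,hdotBr,hdotDl,hdotDr); ring. Qed.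

Lemma norm_normc (a : R[i]) : `|a| = (Normc.normc a)%:C%C.
Proof. by []. Qed.

(** The norm of H is valued in the nonnegative elements of [R[i]]; [rnorm] is the
    same norm with values in R, where infima and limits can be taken. *)
Definition rnorm x : R := complex.Re `|x|.

Lemma rnormE x : `|x| = (rnorm x)%:C%C.
Proof. by rewrite RRe_real ?normr_real. Qed.

Lemma rnorm_ge0 x : 0 <= rnorm x.
Proof. by rewrite -ler0c -rnormE. Qed.

Lemma ler_rnormD x y : rnorm (x + y) <= rnorm x + rnorm y.
Proof. by rewrite -lecR rmorphD /= -!rnormE ler_normD. Qed.

Lemma rparallelogram x y :
  rnorm (x - y) ^+ 2 = 2 * rnorm x ^+ 2 + 2 * rnorm y ^+ 2 - rnorm (x + y) ^+ 2.
Proof.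
apply: complexI; have := parallelogram x y; rewrite !rnormE => e.
by rewrite rmorphB rmorphD /= !(rmorphM _ 2) !rmorphXn /= e rmorph_nat.
Qed.

End InnerProduct.

(** * Bounded operators *)

Section BoundedOperators.
Context {R : realType} {H : hilbertType R}.
Implicit Types (x y z : H) (A B : boundedOperator H).

Lemma bounded_opP (A : boundedOperator H) :
  exists2 M : R, 0 < M & forall x, `|A x| <= M%:C%C * `|x|.
Proof.
have cA : continuous A by exact: cts_fun.
have /linear_boundedP /pinfty_ex_gt0 [M M0 bM] := continuous_linear_bounded 0 (cA 0).
have := gtr0_real M0 => /RRe_real eM.
by exists (complex.Re M); rewrite ?eM // -ltcR eM.
Qed.

Lemma exists_bounded_op (g : H -> H) (M : R) : linear g ->
  (forall x, `|g x| <= M%:C%C * `|x|) -> exists B : boundedOperator H, B =1 g.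
Proof.
move=> glin gM.
pose L : {linear H -> H} := HB.pack g (GRing.isLinear.Build _ _ _ _ g glin).
have gcont : continuous g.
  apply: (@bounded_linear_continuous _ _ _ L); apply/linear_boundedP.
  near=> r => x; apply: (le_trans (gM x)); rewrite ler_wpM2r//.
  by near: r; apply: nbhs_pinfty_ge; rewrite complex_real.
pose B : boundedOperator H := HB.pack g (GRing.isLinear.Build _ _ _ _ g glin)
  (isContinuous.Build _ _ g gcont).
by exists B.
Unshelve. all: by end_near. Qed.

End BoundedOperators.

(** * Riesz representation *)

Section Riesz.
Context {R : realType} {H : hilbertType R}.
Implicit Types (x y z : H) (a : R[i]).

Lemma rnorm_cauchy_cvg (u : nat -> H) :
  (forall e : R, 0 < e -> \forall n \near \oo, forall m, (n <= m)%N ->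
     rnorm (u n - u m) < e) ->
  exists z, forall e : R, 0 < e -> \forall n \near \oo, rnorm (z - u n) < e.
Proof.
move=> cu.
have /cvgrPdist_lt lu : cvg (u @ \oo).
  apply/cauchy_cvgP/cauchy_exP => e e0.
  have e0' := RRe_real (gtr0_real e0).
  have : 0 < complex.Re e by rewrite -ltcR e0'.
  move=> /cu [N _ hN]; exists (u N).
  exists N => // m /= Nm; rewrite -ball_normE /= rnormE -e0' ltcR.
  exact: (hN N (leqnn N) m Nm).
exists (lim (u @ \oo)) => e e0.
have := lu e%:C%C; rewrite ltcR => /(_ e0).
by apply: filterS => n; rewrite rnormE ltcR.
Qed.

(** A nonempty, midpoint-convex, closed set has a point of least
    norm. *)
Lemma min_norm_point (S : set H) : S !=set0 ->
  (forall x y, S x -> S y -> S (2^-1 *: (x + y))) ->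
  (forall z, (forall e : R, 0 < e -> exists2 x, S x & rnorm (z - x) < e) -> S z) ->
  exists2 z, S z & forall x, S x -> rnorm z <= rnorm x.
Proof.
move=> [x0 Sx0] Smid Sclosed.
pose E := [set rnorm x | x in S].
have infE : has_inf E.
  by split; [exists (rnorm x0), x0|exists 0 => _ [x _ <-]; exact: rnorm_ge0].
pose d := inf E.
have dle x : S x -> d <= rnorm x by move=> Sx; apply: ge_inf; [case: infE|exists x].
have d0 : 0 <= d by apply: lb_le_inf; [case: infE|move=> _ [x _ <-]; exact: rnorm_ge0].
have approx n : {x | S x /\ rnorm x < d + n.+1%:R^-1}.
  apply: cid; have n0 : 0 < n.+1%:R^-1 :> R by rewrite invr_gt0.
  by have [_ [x Sx <-] xlt] := inf_adherent n0 infE; exists x.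
pose u n := projT1 (approx n).
have uS n : S (u n) by rewrite /u; case: (approx n) => ? [].
have ult n : rnorm (u n) < d + n.+1%:R^-1 by rewrite /u; case: (approx n) => ? [].
have mid x y : S x -> S y -> 2 * d <= rnorm (x + y).
  move=> Sx Sy; have := dle _ (Smid _ _ Sx Sy).
  rewrite -[_ <= rnorm (_ *: _)]lecR -rnormE normrZ normfV normr_nat rnormE.
  rewrite -[2]/(2%:R) -(rmorph_nat (real_complex R)) -fmorphV -rmorphM lecR /=.
  by rewrite ler_pdivlMl.
(* For x, y in S of norm less than d + del with del <= 1, the parallelogram
   identity and |x + y| >= 2 d give
   |x - y|^2 < 4 (d + del)^2 - 4 d^2 <= 4 (2 d + 1) del. *)
have cu (e : R) : 0 < e -> \forall n \near \oo, forall m, (n <= m)%N ->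
    rnorm (u n - u m) < e.
  move=> e0; have k0 : 0 < e ^+ 2 / (4 * (2 * d + 1)).
    by rewrite divr_gt0 ?exprn_gt0// mulr_gt0// ltr_wpDl// mulr_ge0.
  near=> n.
  have dele : n.+1%:R^-1 < e ^+ 2 / (4 * (2 * d + 1)).
    by near: n; exact: (near_infty_natSinv_lt (PosNum k0)).
  move=> m nm.
  set del : R := n.+1%:R^-1 in dele *.
  have del0 : 0 < del by rewrite invr_gt0.
  have del1 : del <= 1 by rewrite invf_le1 ?ler1n.
  have un : rnorm (u n) < d + del := ult n.
  have um : rnorm (u m) < d + del.
    apply: (lt_le_trans (ult m)); rewrite lerD2l lef_pV2 ?posrE// ler_nat.
    by rewrite ltnS.
  rewrite -ltr_sqr ?nnegrE ?rnorm_ge0 ?ltW// rparallelogram.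
  have := mid _ _ (uS n) (uS m).
  have := rnorm_ge0 (u n); have := rnorm_ge0 (u m).
  move: dele; rewrite ltr_pdivlMr; last lra.
  move: (rnorm (u n)) (rnorm (u m)) (rnorm _) un um => a b c; nra.
have [z zlim] := rnorm_cauchy_cvg cu.
exists z; first by apply: Sclosed => e /zlim [N _ /(_ N (leqnn N)) hN]; exists (u N).
move=> x /dle; apply: le_trans.
suff le_eps (e : R) : 0 < e -> rnorm z <= d + e by apply/ler_addgt0Pr.
move=> e0.
have e20 : 0 < e / 2 by rewrite divr_gt0.
have [N [h1 h2]] : exists N, N.+1%:R^-1 < e / 2 /\ rnorm (z - u N) < e / 2.
  have [N _ hN] : \forall n \near \oo, n.+1%:R^-1 < e / 2 /\ rnorm (z - u n) < e / 2.
    by near=> n; split; near: n; [exact: (near_infty_natSinv_lt (PosNum e20))|exact: zlim].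
  by exists N; exact: hN N (leqnn N).
have := ler_rnormD (z - u N) (u N); rewrite subrK.
have := ult N; move: h1 h2; move: (rnorm _) (rnorm _) (rnorm _) (_^-1) => p q r v; lra.
Unshelve. all: by end_near. Qed.

(** Riesz representation theorem for a linear form of norm at most C. *)
Lemma riesz (f : H -> R[i]) (C : R) : 0 < C -> linear (f : H -> R[i]^o) ->
  (forall x, `|f x| <= C%:C%C * `|x|) -> exists y, forall x, f x = hdot x y.
Proof.
move=> C0 flin fC.
have fB x y : f (x - y) = f x - f y.
  by rewrite addrC -scaleN1r flin scaleN1r addrC.
have f0 : f 0 = 0 by rewrite -(subrr 0) fB subrr.
have fD x y : f (x + y) = f x + f y.
  by have := flin 1 x y; rewrite !scale1r.
have fZ a x : f (a *: x) = a * f x by have := flin a x 0; rewrite f0 !addr0.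
have [[u fu]|/forallNP f_eq0] := pselect (exists u, f u <> 0); last first.
  by exists 0 => x; rewrite hdot0r; apply: contrapT; exact: f_eq0.
have [||z2 Sz2|z /= fz zmin] := @min_norm_point [set x | f x = 1].
- by exists ((f u)^-1 *: u); rewrite /= fZ mulVf//; exact/eqP.
- by move=> x y /= fx fy; rewrite fZ fD fx fy mulVf ?pnatr_eq0.
- (* The bound makes f continuous, so this affine hyperplane is closed. *)
  apply/eqP; rewrite -subr_eq0; apply: contrapT => /negP fz2.
  have p0 : 0 < Normc.normc (f z2 - 1) by rewrite -ltcR -norm_normc normr_gt0.
  have [x /= fx xlt] := Sz2 _ (divr_gt0 p0 C0).
  have := fC (z2 - x); rewrite fB fx rnormE norm_normc -rmorphM lecR /=.
  by rewrite leNgt mulrC -ltr_pdivlMr// xlt.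
have z0 : `|z| ^+ 2 != 0.
  rewrite expf_eq0 normr_eq0 /=; apply/eqP => z0.
  by move: fz; rewrite z0 f0 => /eqP; rewrite eq_sym oner_eq0.
(* Moving z along w stays in the hyperplane f = 1, so the projection of z on w
   vanishes by minimality. *)
have ker w : f w = 0 -> hdot z w = 0.
  move=> fw; have [->|w0] := eqVneq w 0; first exact: hdot0r.
  have : rnorm z <= rnorm (z - (hdot z w / `|w| ^+ 2) *: w).
    by apply: zmin; rewrite /= fB fZ fw fz mulr0 subr0.
  rewrite -lecR -!rnormE -ler_sqr ?nnegrE// norm_sub_proj// -subr_ge0 addrAC subrr add0r.
  rewrite oppr_ge0 ler_pdivrMr ?mul0r ?exprn_gt0 ?normr_gt0//.
  by move=> le0; apply/eqP; rewrite -normr_eq0 -sqrf_eq0 eq_le le0 exprn_ge0.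
exists (`|z| ^- 2 *: z) => x.
have := ker (x - f x *: z); rewrite fB fZ fz mulr1 subrr => /(_ erefl).
move=> /(congr1 (@Num.conj _)); rewrite -hdotC conjC0 hdotBl hdotZl -hdot_norm.
move=> /eqP; rewrite subr_eq0 => /eqP e; rewrite hdotZr e.
rewrite fmorphV rmorphXn /= (CrealP (normr_real z)).
by field; move: z0; rewrite expf_eq0.
Qed.

End Riesz.

(** * Adjoints and inverses *)

Section Adjoint.
Context {R : realType} {H : hilbertType R}.
Implicit Types (x y z : H) (A B : boundedOperator H).

Lemma exists_adjoint (A : boundedOperator H) :
  exists B : boundedOperator H, forall x y, hdot (A x) y = hdot x (B y).
Proof.
have [M M0 AM] := bounded_opP A.
have /choice[g gP] y : exists z, forall x, hdot (A x) y = hdot x z.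
  (* The 1 keeps the bound positive when y = 0. *)
  apply: (@riesz _ _ _ (M * (rnorm y + 1))).
  - by rewrite mulr_gt0// ltr_wpDl// rnorm_ge0.
  - by move=> a u v; rewrite linearP hdotDl hdotZl.
  - move=> x; apply: (le_trans (CauchySchwarz_norm _ _)).
    apply: (@le_trans _ _ (M%:C%C * `|x| * `|y|)); first by rewrite ler_wpM2r.
    rewrite !rnormE -!rmorphM lecR /= -!mulrA ler_wpM2l ?(ltW M0)//.
    by rewrite mulrC ler_wpM2r ?rnorm_ge0// lerDl.
have glin : linear g.
  move=> a u v; apply: hdot_injr => x.
  by rewrite -gP !(hdotDr, hdotZr) !gP.
have gM x : `|g x| <= M%:C%C * `|x|.
  have [->|gx0] := eqVneq (g x) 0.
    by rewrite normr0 mulr_ge0// ler0c ltW.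
  have gx_gt0 : 0 < `|g x| by rewrite normr_gt0.
  rewrite -(ler_pM2r gx_gt0) -expr2 hdot_norm -gP.
  apply: le_trans (real_ler_norm _) _.
    by rewrite gP -hdot_norm rpredX ?normr_real.
  apply: (le_trans (CauchySchwarz_norm _ _)).
  by rewrite mulrAC ler_wpM2r.
have [B Bg] := exists_bounded_op glin gM.
by exists B => x y; rewrite Bg.
Qed.

(** Defining property of the adjoint: the default value is not used. *)
Lemma adjointE (A : boundedOperator H) x y : hdot (A x) y = hdot x (adjoint A y).
Proof.
have [B BP] := exists_adjoint A.
by have /= := @xgetPex _ A [set B | forall x y, hdot (A x) y = hdot x (B y)]
  (ex_intro _ B BP); apply.
Qed.

Lemma adjointEl (A : boundedOperator H) x y : hdot (adjoint A x) y = hdot x (A y).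
Proof. by rewrite hdotC -adjointE -hdotC. Qed.

(** The default value in [opinv] is not used on invertible operators. *)
Lemma opinvP (A : boundedOperator H) : invertible A -> is_inverse A (opinv A).
Proof. by move=> [B AB]; apply: (@xgetPex _ A [set B | is_inverse A B]); exists B. Qed.

Lemma invertible_gram (A : boundedOperator H) :
  invertible A -> invertible (opcomp (adjoint A) A).
Proof.
move=> [B [AB BA]]; exists (opcomp B (adjoint B)).
split=> x; rewrite /opcomp /=.
  rewrite -[RHS]AB; congr (B _); apply: hdot_injr => z.
  by rewrite -!adjointE BA.
rewrite -[LHS]/(adjoint A (A (B (adjoint B x)))) BA; apply: hdot_injr => z.
by rewrite -!adjointE AB.
Qed.

(** If T is the Gram operator A^* A, S a right inverse of T, and k a unit vector
    on which the quadratic forms of T and S are at most 1, then T fixes k. *)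
Lemma gram_fixed_point (A T S : boundedOperator H) (k : H) :
  (forall x y, hdot (T x) y = hdot (A x) (A y)) -> cancel S T -> `|k| = 1 ->
  `|hdot (T k) k| <= 1 -> `|hdot (S k) k| <= 1 -> T k = k.
Proof.
move=> TE ST k1 Tle Sle.
have kk : hdot k k = 1 by rewrite -hdot_norm k1 expr1n.
have {}Tle : hdot (T k) k <= 1.
  apply: le_trans (real_ler_norm _) Tle.
  by rewrite TE -hdot_norm rpredX ?normr_real.
have {}Sle : hdot k (S k) <= 1.
  have kS : hdot k (S k) = `|A (S k)| ^+ 2 by rewrite -{1}(ST k) TE hdot_norm.
  by move: Sle; rewrite hdotC norm_conjC kS normrX normr_id.
have TkS : hdot (T k) (S k) = 1 by rewrite TE hdotC -TE ST kk rmorph1.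
have TB : T (k - S k) = T k - k by rewrite linearB; congr (_ - _); exact: ST.
have AkS : A (k - S k) = 0.
  apply/eqP; rewrite -normr_eq0 -sqrf_eq0 eq_le exprn_ge0// andbT.
  rewrite hdot_norm -TE TB hdotBl !hdotBr TkS kk.
  have -> : hdot (T k) k - 1 - (1 - hdot k (S k))
    = (hdot (T k) k - 1) + (hdot k (S k) - 1) by ring.
  by rewrite -[leRHS]addr0 lerD ?subr_le0.
have : T (k - S k) = 0.
  by apply: hdot_eq0; rewrite TE AkS hdot0l.
by rewrite TB => /eqP; rewrite subr_eq0 => /eqP.
Qed.

End Adjoint.

(** * Reproducing kernels and the t-Berezin norm *)

Section Berezin.
Context {R : realType} {Omega : Type} {H : functionalHilbertType R Omega}.
Context (kernel_neq0 : forall l : Omega, rkernel l <> 0 :> H).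
Implicit Types (l m : Omega) (A : boundedOperator H).

(** Reproducing property: a nonzero [rkernel l] is not the default value. *)
Lemma rkernelP l (f : H) : feval f l = hdot f (rkernel l).
Proof.
have := @kernel_neq0 l; rewrite /rkernel.
by case: xgetP => [k _ kP _|_]; [exact: kP|case].
Qed.

Lemma norm_nrkernel l : `|nrkernel l : H| = 1.
Proof.
rewrite normrZ normfV normr_id mulVf// normr_eq0.
exact/eqP/kernel_neq0.
Qed.

Lemma hdot_nrkernel_eq0 l (f : H) : hdot f (nrkernel l) = 0 -> feval f l = 0.
Proof.
rewrite hdotZr => /eqP; rewrite mulf_eq0 conjC_eq0 invr_eq0 normr_eq0.
by rewrite rkernelP => /orP[/eqP /kernel_neq0 //|/eqP].
Qed.

Lemma normc_hdot_nrkernel A (M : R) l m :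
  (forall x, `|A x| <= M%:C%C * `|x|) ->
  Normc.normc (hdot (A (nrkernel l)) (nrkernel m)) <= M.
Proof.
move=> AM; rewrite -lecR -norm_normc (le_trans (CauchySchwarz_norm _ _))//.
by rewrite norm_nrkernel mulr1 (le_trans (AM _))// norm_nrkernel mulr1.
Qed.

Lemma tber_id_le1 (t : R) A : inhabited Omega -> A =1 idfun -> tber t A <= 1.
Proof.
move=> [l0] A1; apply: ge_sup.
  by eexists; exists l0, l0.
have A'1 x : adjoint A x = x by apply: hdot_injr => z; rewrite -adjointE A1.
have bnd l m : Normc.normc (hdot (nrkernel l : H) (nrkernel m)) <= 1.
  by rewrite -lecR -norm_normc (le_trans (CauchySchwarz_norm _ _))// !norm_nrkernel mulr1.
move=> _ [l [m ->]]; rewrite A1 A'1 -mulrDl addrC subrK mul1r; exact: bnd.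
Qed.

(** The diagonal terms of A and of its adjoint have the same modulus, so their
    weighted sum does not depend on t; nonnegative weights are needed for the
    supremum to be that of a bounded set. *)
Lemma normc_hdot_le_tber (t : R) A l : 0 <= t -> t <= 1 ->
  Normc.normc (hdot (A (nrkernel l)) (nrkernel l)) <= tber t A.
Proof.
move=> t0 t1.
have [M M0 AM] := bounded_opP A; have [N N0 AN] := bounded_opP (adjoint A).
apply: ub_le_sup; last first.
  exists l, l; rewrite adjointEl (hdotC (A _)).
  have -> (a : R[i]) : Normc.normc a^*%R = Normc.normc a.
    by apply: complexI; rewrite -!norm_normc norm_conjC.
  by rewrite -mulrDl addrC subrK mul1r.
exists (t * M + (1 - t) * N) => _ [l1 [m ->]].
by rewrite lerD// ler_wpM2l ?subr_ge0//; exact: normc_hdot_nrkernel.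
Qed.

Lemma hdot_nrkernel_le1 (t : R) A l : 0 <= t -> t <= 1 -> tber t A <= 1 ->
  `|hdot (A (nrkernel l)) (nrkernel l)| <= 1.
Proof.
move=> t0 t1 A1; rewrite norm_normc lecR.
exact: le_trans (normc_hdot_le_tber _ _ _ _) A1.
Qed.

End Berezin.

Theorem proposition2p8 (R : realType) (Omega : Type)
    (Omega_nonempty : inhabited Omega)
    (H : functionalHilbertType R Omega)
    (kernel_neq0 : forall l : Omega, rkernel l <> 0 :> H)
    (t : R) (t_ge0 : 0 <= t) (t_le1 : t <= 1)
    (A : boundedOperator H) (A_invertible : invertible A) :
  unitary A <->
  tber t (opcomp (adjoint A) A) <= 1 /\
  tber t (opinv (opcomp (adjoint A) A)) <= 1.
Proof.
have [TS ST] := opinvP (invertible_gram A_invertible).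
split.
  move=> [A1 _]; split; first exact: tber_id_le1.
  by apply: tber_id_le1 => // x; rewrite -[RHS]TS; congr (opinv _ _); exact/esym/A1.
move=> [T1 S1].
have TE x y : hdot (opcomp (adjoint A) A x) y = hdot (A x) (A y).
  by rewrite /opcomp /= adjointEl.
have Tk l : opcomp (adjoint A) A (nrkernel l) = nrkernel l.
  apply: (@gram_fixed_point _ _ A (opcomp (adjoint A) A) _ _ TE ST).
  - exact: norm_nrkernel.
  - exact: hdot_nrkernel_le1 T1.
  - exact: hdot_nrkernel_le1 S1.
have Tid : opcomp (adjoint A) A =1 idfun.
  move=> x; apply: (@feval_inj _ _ H); apply/funext => l.
  apply/eqP; rewrite -subr_eq0; apply/eqP.
  rewrite !rkernelP// -hdotBl -rkernelP//; apply: hdot_nrkernel_eq0 => //.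
  by rewrite hdotBl TE adjointE -[adjoint A _]/(opcomp (adjoint A) A _) Tk subrr.
split=> // y; have [B [_ BA]] := A_invertible.
by rewrite -[y]BA; congr (A _); exact: Tid.
Qed.
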